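(* Let $\rho\in[0.50,0.851]$ and suppose the unbiased Bernoulli convolution $\mu_\rho$ satisfies the asymptotically weak separation condition. Then for all $x\in[0,1]$ the lower local dimension of $\mu_\rho$ at $x$ satisfies the following bounds: - if $\rho\in[0.50,0.55]$, then $\underline{\dim}_{\mathrm{loc}}\,\mu_\rho(x)\ge 0.792021$; - if $\rho\in[0.55,0.60]$, then $\underline{\dim}_{\mathrm{loc}}\,\mu_\rho(x)\ge 0.825663$; - if $\rho\in[0.60,0.65]$, then $\underline{\dim}_{\mathrm{loc}}\,\mu_\rho(x)\ge 0.840348$; - if $\rho\in[0.65,0.70]$, then $\underline{\dim}_{\mathrm{loc}}\,\mu_\rho(x)\ge 0.824701$; - if $\rho\in[0.70,0.75]$, then $\underline{\dim}_{\mathrm{loc}}\,\mu_\rho(x)\ge 0.750984$; - if $\rho\in[0.75,0.80]$, then $\underline{\dim}_{\mathrm{loc}}\,\mu_\rho(x)\ge 0.635012$; - if $\rho\in[0.80,0.851]$, then $\underline{\dim}_{\mathrm{loc}}\,\mu_\rho(x)\ge 0.416226$.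
   Context: The unbiased Bernoulli convolution $\mu_\rho$ is the unique Borel probability measure satisfying $\mu_\rho=\frac12\mu_\rho\circ S_0^{-1}+\frac12\mu_\rho\circ S_1^{-1}$, where $S_0(x)=\rho x$ and $S_1(x)=\rho x+1-\rho$; its support is $[0,1]$. For a word $\sigma=(\sigma_1,\dots,\sigma_n)\in\{0,1\}^n$ put $S_\sigma=S_{\sigma_1}\circ\dots\circ S_{\sigma_n}$. The measure (or its IFS) satisfies the asymptotically weak separation condition if there is a sequence $f(n)$ with $\log f(n)/n\to0$ as $n\to\infty$ such that for each $n\in\mathbb{N}$ and each $x\in[0,1]$, $$\#\{S_\sigma[0,1]:\sigma\in\{0,1\}^n,\ S_\sigma[0,1]\cap(x-\rho^n,x+\rho^n)\neq\emptyset\}\le f(n),$$ where the left side counts distinct intervals (coinciding images are counted once). The lower local dimension of $\mu$ at $x\in\operatorname{supp}\mu$ is $\underline{\dim}_{\mathrm{loc}}\,\mu(x)=\liminf_{\epsilon\to0^+}\frac{\log\mu([x-\epsilon,x+\epsilon])}{\log\epsilon}$. *)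

(* Defs.v *)
From HB Require Import structures.
From mathcomp Require Import all_boot all_order all_algebra finmap.
From mathcomp Require Import all_classical all_reals all_analysis.

Set Implicit Arguments.
Unset Strict Implicit.
Unset Printing Implicit Defensive.

Import Order.TTheory GRing.Theory Num.Theory.
Import numFieldNormedType.Exports.

Local Open Scope classical_set_scope.
Local Open Scope ring_scope.

Definition bern_map (R : realType) (rho : R) (i : bool) (x : R) : R :=
  if i then rho * x + 1 - rho else rho * x.

Definition bern_word (R : realType) (rho : R) (s : seq bool) : R -> R :=
  foldr (fun i g => bern_map rho i \o g) idfun s.

(* For 0 < rho < 1 exactly one probability measure satisfies this. *)
Definition bernoulli_convolution (R : realType) (rho : R)
    (mu : probability (measurableTypeR R) R) : Prop :=
  forall A : set (measurableTypeR R), measurable A ->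
    mu A = ((2^-1)%:E * pushforward mu (bern_map rho false) A
          + (2^-1)%:E * pushforward mu (bern_map rho true) A)%E.

(* A set of sets, so that coinciding images are counted once. *)
Definition nearby_images (R : realType) (rho : R) (n : nat) (x : R) :
    set (set R) :=
  [set bern_word rho s @` `[0, 1] | s in [set s : n.-tuple bool |
     bern_word rho s @` `[0, 1] `&` `]x - rho ^+ n, x + rho ^+ n[ !=set0]].

(* The set being counted is the image of a finite type, hence finite; the count
   is at least 1 at x = 0, so the bound forces 1 <= f n and ln is never
   evaluated at a junk argument. *)
Definition asymptotically_weak_separation (R : realType) (rho : R) : Prop :=
  exists f : nat -> R,
    (ln (f n) / n%:R @[n --> \oo] --> 0) /\
    forall (n : nat) (x : R), 0 <= x <= 1 ->
      #|` fset_set (nearby_images rho n x)|%:R <= f n.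

(* lne 0 = -oo, so the quotient is +oo where the interval has measure 0. *)
Definition lower_local_dim (R : realType)
    (mu : probability (measurableTypeR R) R) (x : R) : \bar R :=
  limf_einf (fun e : R =>
    let m := mu `[x - e, x + e]%classic in (lne m / (ln e)%:E)%E) 0^'+.

(* Main.v *)
(** A ball B(x, r) has mu-measure the mean of the measures of its preimages
    B(T0 x, r / rho) and B(T1 x, r / rho), where T0 y = y / rho and
    T1 y = (y - 1) / rho + 1 are the inverses of the two maps. If psi vanishes
    far from [0, 1], is at least 1 near [0, 1] and satisfies
    psi (T0 y) + psi (T1 y) <= lam * psi y everywhere, then iterating m times
    gives mu B(x, r) <= (lam / 2) ^ m * psi x as soon as r <= delta * rho ^ m;
    hence the lower local dimension is at least s whenever
    lam / 2 <= rho ^ s' for some s' > s. The range of rho is cut into short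
    intervals, and on each of them one function psi, constant on the cells of a
    grid, serves for all rho: the inequality then reduces to finitely many
    integer inequalities, which are checked by computation. *)

Require Import Defs.
From Stdlib Require Import BinNat.
From mathcomp Require Import all_boot all_order all_algebra.
From mathcomp Require Import all_classical all_reals all_analysis.
From mathcomp Require Import zify ring lra.

Set Implicit Arguments.
Unset Strict Implicit.
Unset Printing Implicit Defensive.

Import Order.TTheory GRing.Theory Num.Theory.
Local Open Scope ring_scope.

(** * Decay of ball measures and the local dimension of a Bernoulli convolution *)

Section Frostman.
Variables (R : realType) (rho : R) (mu : probability (measurableTypeR R) R).
Hypotheses (rho0 : 0 < rho) (rho1 : rho < 1).
Hypothesis hmu : bernoulli_convolution rho mu.

Lemma bernoulli_ball (x r : R) :
  (mu `[(x - r)%R, (x + r)%R]%classic =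
   (2^-1)%:E * mu `[(x / rho - r / rho)%R, (x / rho + r / rho)%R]%classic +
   (2^-1)%:E * mu `[((x - 1) / rho + 1 - r / rho)%R,
                    ((x - 1) / rho + 1 + r / rho)%R]%classic)%E.
Proof.
have nz : rho != 0 by rewrite gt_eqF.
rewrite hmu; last exact: measurable_itv.
have le_rho (u v : R) : (u <= v) = (rho * u <= rho * v) by rewrite ler_pM2l.
have ex y : y / rho = rho^-1 * y by rewrite mulrC.
rewrite /pushforward; congr (_ * mu _ + _ * mu _)%E;
  apply/seteqP; split=> z; rewrite /= !in_itv /bern_map /=;
  rewrite ?[_ / rho + _ - _ <= _]le_rho ?[_ / rho - _ <= _]le_rho ?[z <= _]le_rho
   ?mulrDr ?mulrN ?ex ?mulVKf // ?mulr1;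
  move=> /andP[h1 h2]; apply/andP; split; lra.
Qed.

(* Self-similarity bounds the measure of a neighbourhood of [0, 1] below by that
   of the neighbourhood rho^-1 times as wide, hence by 1 in the limit. *)
Lemma bernoulli_support (t : R) :
  0 < t -> mu `[(- t)%R, (1 + t)%R]%classic = 1%E.
Proof.
move=> t0; apply/eqP; rewrite eq_le probability_le1 ?measurable_itv //=.
pose s n := t / rho ^+ n.
pose F n : set (measurableTypeR R) := `[(- s n)%R, (1 + s n)%R]%classic.
have mF n : measurable (F n) by exact: measurable_itv.
have s0 n : 0 < s n by rewrite divr_gt0 ?exprn_gt0.
have sS n : s n.+1 = s n / rho by rewrite /s exprSr invfM mulrA.
have s_le n : s n <= s n.+1.
  by rewrite sS ler_pdivlMr // ler_piMr // ltW.
have s_homo : {homo s : m n / (m <= n)%N >-> m <= n}.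
  by apply/nondecreasing_seqP.
(* [F n] is the ball about 1/2 of radius 1/2 + [s n]; each of its two preimages contains [F n.+1],
   so the mean of their measures is at least that of [F n.+1]. *)
have FS n : (mu (F n.+1) <= mu (F n))%E.
  have -> : F n = `[(2^-1 - (2^-1 + s n))%R, (2^-1 + (2^-1 + s n))%R]%classic.
    by rewrite /F opprD !addrA subrr sub0r (_ : 2^-1 + 2^-1 = 1) //; lra.
  rewrite bernoulli_ball.
  have rhoi : 1 <= rho^-1 by rewrite invf_ge1 // ltW.
  have sp := s0 n.+1.
  rewrite [leLHS](_ : _ = (2^-1)%:E * mu (F n.+1) + (2^-1)%:E * mu (F n.+1))%E; last first.
    by rewrite -ge0_muleDl ?lee_fin ?invr_ge0 // -EFinD
      (_ : 2^-1 + 2^-1 = 1 :> R) ?mul1e //; lra.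
  apply: leeD; apply: lee_wpmul2l; rewrite ?lee_fin ?invr_ge0 //;
    apply: le_measure;
    rewrite ?inE //; try exact: measurable_itv;
    move=> z; rewrite /F /= !in_itv /= sS !mulrDl => /andP[h1 h2]; apply/andP; split; lra.
have FE : (\bigcup_n F n = setT)%classic.
  rewrite -subTset => z _.
  (* As [s n] never drops below [t], each increment is at least [d]; linear growth makes the [F n]
     exhaust the line. *)
  pose d := t * (rho^-1 - 1).
  have d0 : 0 < d by rewrite mulr_gt0 // subr_gt0 invf_gt1.
  have sd n : n%:R * d <= s n.
    elim: n => [|n IH]; first by rewrite mul0r ltW.
    have st : t <= s n by have := s_homo _ _ (leq0n n); rewrite {1}/s expr0 divr1.
    have : d <= s n * (rho^-1 - 1) by rewrite ler_wpM2r // subr_ge0 invf_ge1 // ltW.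
    rewrite -natr1 mulrDl mul1r sS; lra.
  exists (Num.truncn (`|z| / d)).+1 => //; rewrite /F /= in_itv /=.
  have := truncnS_gt (`|z| / d); rewrite ltr_pdivrMr // => /lt_le_trans/(_ (sd _)).
  by rewrite ltr_norml => /andP[h1 h2]; apply/andP; split; lra.
have cF : (mu (F n) @[n --> \oo] --> 1%E)%classic.
  rewrite -(@probability_setT _ _ _ mu) -FE; apply: nondecreasing_cvg_mu => //.
    by rewrite FE.
  move=> m n mn; apply/subsetPset => z; rewrite /F /= !in_itv /=.
  have := s_homo _ _ mn; move=> h /andP[h1 h2]; apply/andP; split; lra.
have F0 n : (mu (F n) <= mu (F 0%N))%E.
  by elim: n => // n; apply: le_trans.
have -> : `[(- t)%R, (1 + t)%R]%classic = F 0%N by rewrite /F /s expr0 divr1.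
rewrite -(cvg_lim _ cF) //; apply: lime_le; first by apply/cvg_ex; exists 1%E.
by near=> n; exact: F0.
Unshelve. all: end_near.
Qed.

Lemma frostman_bound (psi : R -> R) (lam delta : R) :
  0 <= lam -> 0 < delta ->
  (forall x, 0 <= psi x) ->
  (forall x, - delta <= x <= 1 + delta -> 1 <= psi x) ->
  (forall x, psi (x / rho) + psi ((x - 1) / rho + 1) <= lam * psi x) ->
  forall m x r, r <= delta * rho ^+ m ->
    (mu `[(x - r)%R, (x + r)%R]%classic <= ((lam / 2) ^+ m * psi x)%:E)%E.
Proof.
move=> lam0 delta0 psi0 psi1 hpsi; elim=> [|m IH] x r.
  rewrite expr0 mulr1 mul1r => rdelta.
  have [xin|] := boolP (- delta <= x <= 1 + delta).
    rewrite (le_trans (probability_le1 _ _)) ?measurable_itv ?lee_fin ?psi1 //.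
  (* Now [x] is farther than [delta] from [0, 1] and [r <= delta], so the ball misses a whole
     neighbourhood of [0, 1] and is null; [t] is half the remaining gap. *)
  rewrite negb_and -!ltNge => xout.
  have [t t0 ht] : exists2 t, 0 < t &
      (`[(x - r)%R, (x + r)%R] `<=` ~` `[(- t)%R, (1 + t)%R])%classic.
    have [xl|xr] : x < - delta \/ 1 + delta < x by apply/orP.
      exists (- (x + delta) / 2) => [|z]; rewrite /= ?in_itv /=; first lra.
      by move=> /andP[h1 h2] /andP[h3 h4]; lra.
    exists ((x - 1 - delta) / 2) => [|z]; rewrite /= ?in_itv /=; first lra.
    by move=> /andP[h1 h2] /andP[h3 h4]; lra.
  apply: (@le_trans _ _ 0%E); last by rewrite lee_fin.
  have <- : mu (~` `[(- t)%R, (1 + t)%R])%classic = 0%E.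
    rewrite probability_setC; last exact: measurable_itv.
    by rewrite bernoulli_support // subee.
  by apply: le_measure => //; rewrite inE; [|apply: measurableC]; exact: measurable_itv.
rewrite exprSr mulrA -ler_pdivrMr // => hr.
rewrite bernoulli_ball.
have kap0 : 0 <= (lam / 2) ^+ m by rewrite exprn_ge0 // divr_ge0.
apply: le_trans (leeD _ _) _.
- by apply: lee_wpmul2l (IH _ _ hr); rewrite lee_fin invr_ge0.
- by apply: lee_wpmul2l (IH _ _ hr); rewrite lee_fin invr_ge0.
rewrite -!EFinM -EFinD lee_fin exprSr -mulrDr -mulrDr mulrCA -mulrA ler_wpM2l //.
by have := hpsi x; lra.
Qed.

(** Passes from the scales [delta * rho ^+ m] to all small radii: the gap between [s] and [s']
    absorbs [C], [delta] and the rounding of the radius to a scale. *)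
Lemma le_lower_local_dim (x C delta kappa s s' : R) :
  0 < C -> 0 < delta -> 0 < kappa -> ln kappa <= s' * ln rho -> 0 < s -> s < s' ->
  (forall m r, r <= delta * rho ^+ m ->
    (mu `[(x - r)%R, (x + r)%R]%classic <= (C * kappa ^+ m)%:E)%E) ->
  (s%:E <= lower_local_dim mu x)%E.
Proof.
move=> C0 delta0 kappa0 hkappa s0 ss' hmux.
have lnrho : ln rho < 0 by rewrite ln_lt0 // rho0.
(* With [m] as below, the log of the measure is at most [s' * ln e + K]; this is at most [s * ln e]
   once [ln e <= - K / (s' - s)], whence the last term of [e0]. *)
pose K := ln C - s' * (ln delta + ln rho).
pose e0 := Num.min (Num.min 1 delta) (expR (- (K / (s' - s)))).
have e00 : 0 < e0 by rewrite !lt_min ltr01 delta0 expR_gt0.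
rewrite /lower_local_dim limf_einfE.
apply: le_trans (ereal_sup_ubound _); last first.
  exists [set e | 0 < e < e0]%classic => //.
  near=> e => /=; apply/andP; split; near: e.
    exact: nbhs_right_gt.
  exact: nbhs_right_lt.
apply: le_ereal_inf_tmp => _ [e /= /andP[ee0 ee1] <-].
move: ee1; rewrite !lt_min => /andP[/andP[e1 edelta] eK].
have lne0 : ln e < 0 by rewrite ln_lt0 // ee0.
have neg : (0 < (- ln e)%R)%R by rewrite oppr_gt0.
(* The largest [m] with [e <= delta * rho ^+ m]; maximality costs one extra [ln rho] in [hm2]. *)
pose m := Num.truncn ((ln e - ln delta) / ln rho).
have q0 : 0 <= (ln e - ln delta) / ln rho.
  rewrite -mulrNN -invrN mulr_ge0 ?invr_ge0 ?oppr_ge0 ?ltW //.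
  by rewrite subr_lt0 ltr_ln.
have /andP[m1 m2] := truncn_itv q0.
have hm1 : ln e <= ln delta + m%:R * ln rho.
  by move: m1; rewrite -/m ler_ndivlMr // => h; lra.
have hm2 : ln delta + m%:R * ln rho + ln rho <= ln e.
  by move: m2; rewrite -/m ltr_ndivrMr // -natr1 mulrDl mul1r => h; lra.
have hr : e <= delta * rho ^+ m.
  rewrite -ler_ln ?posrE ?mulr_gt0 ?exprn_gt0 //.
  by rewrite lnM ?posrE ?exprn_gt0 // lnXn // -mulr_natl.
have bound : ln (C * kappa ^+ m) <= s * ln e.
  rewrite lnM ?posrE ?exprn_gt0 // lnXn // -mulr_natl.
  have : m%:R * ln kappa <= m%:R * (s' * ln rho) by rewrite ler_wpM2l.
  have : s' * (ln delta + m%:R * ln rho + ln rho) <= s' * ln e.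
    by rewrite ler_wpM2l // ltW // (lt_trans s0).
  have : (s' - s) * ln e <= - K.
    rewrite mulrC -ler_pdivlMr ?subr_gt0 // mulNr -[leRHS]expRK.
    by rewrite ler_ln ?posrE ?expR_gt0 // ltW.
  rewrite /K; clear -C; lra.
have hb : (lne (mu `[(x - e)%R, (x + e)%R]%classic) <= (s * ln e)%:E)%E.
  have Ck : 0 < C * kappa ^+ m by rewrite mulr_gt0 ?exprn_gt0.
  apply: (@le_trans _ _ (lne (C * kappa ^+ m)%:E)); last by rewrite lne_EFin // lee_fin.
  by rewrite lee_lne ?hmux // in_itv /= leey ?measure_ge0 // lee_fin ltW.
rewrite inver lt_eqF //.
move: (lne _) hb => [z| |] //.
- by rewrite lee_fin -EFinM lee_fin ler_ndivlMr.
(* Null ball: -oo divided by the negative [ln e] is +oo. *)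
- by move=> _; rewrite mulNyr ltr0_sg ?invr_lt0 // mulN1e leey.
Unshelve. all: end_near.
Qed.
End Frostman.

(** * Integer tests for the supersolution inequality *)

(* With p = [:: p_0; ...; p_(n+1)], psi takes the value p_i on
   [(i - 1) / n, i / n) and 0 outside [- 1 / n, 1 + 1 / n). The test is a
   necessary condition for T0 to map a point of cell i into cell j for some rho
   in [A / D, B / D]; the cells are translated by 1 to avoid negative numbers. *)
Definition meets (A B D i j : N) : bool :=
  N.ltb (N.mul A j) (N.add (N.mul D i) A) &&
  N.ltb (N.mul D i) (N.add (N.mul B j) D).

(** An upper bound for psi o T0 on cell [i]; [j] is the index of the head of [p], and 0 is the value
    of psi off the grid. *)
Fixpoint peak (A B D i j : N) (p : seq N) : N :=
  if p is c :: p' then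
    let m := peak A B D i (N.succ j) p' in
    if meets A B D i j then N.max c m else m
  else 0%num.

Definition peaks (A B D : N) (p : seq N) : seq N :=
  [seq peak A B D (bin_of_nat i) 0 p | i <- iota 0 (size p)].

(* For a palindrome p the bound for T1 is the bound for T0 at the mirror cell. *)
Definition supersolution (A B D P Q : N) (p : seq N) : bool :=
  let s := peaks A B D p in
  all2 (fun c m => N.ltb 0 c && N.leb (N.mul Q m) (N.mul P c))
    p [seq N.add m.1 m.2 | m <- zip s (rev s)].

Lemma meetsP (A B D : N) (i j : nat) :
  (A * j < D * i + A)%N -> (D * i < B * j + D)%N ->
  meets A B D (bin_of_nat i) (bin_of_nat j).
Proof. by move=> h1 h2; apply/andP; split; lia. Qed.

(** The real inequalities hold whenever points z of cell [i] and z0 of cell [j] satisfy z - 1 = rho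
    (z0 - 1); the endpoints A / D and B / D then replace rho. *)
Lemma meets_ratio (R : realType) (rho : R) (A B D : N) (i j : nat) :
  (0 < A)%N -> (0 < D)%N -> 0 < rho -> A%:R <= D%:R * rho <= B%:R ->
  rho * (j%:R - 1) < i%:R -> i%:R - 1 < rho * j%:R ->
  meets A B D (bin_of_nat i) (bin_of_nat j).
Proof.
rewrite -!(ltr0n R) => A0 D0 rho0 /andP[hA hB] h1 h2.
rewrite -(ltr_pM2l D0) in h1; rewrite -(ltr_pM2l D0) in h2.
apply: meetsP; rewrite -(ltr_nat R) !natrD !natrM.
  (* For [j = 0] the factor [j - 1] is negative and cannot multiply [A <= D * rho], but [0 < A]
     suffices. *)
  have [->|j0] := posnP j; first by rewrite mulr0 ltr_wpDl // mulr_ge0.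
  have : 0 <= j%:R - 1 :> R by rewrite subr_ge0 ler1n.
  by move=> /ler_wpM2r/(_ _ _ hA) /=; lra.
by have /= := ler_wpM2r (ler0n R j) hB; lra.
Qed.

Lemma le_peak (A B D i : N) (p : seq N) (j k : nat) :
  meets A B D i (bin_of_nat (j + k)) ->
  (nth 0%num p k <= peak A B D i (bin_of_nat j) p)%N.
Proof.
elim: p j k => [|c p IH] j [|k] //=.
  by rewrite addn0 => ->; lia.
rewrite addnS -addSn => /IH; rewrite (_ : N.succ _ = bin_of_nat j.+1); last lia.
by case: ifP => _; lia.
Qed.

Lemma nth_peaks (A B D : N) (p : seq N) (i j : nat) :
  (i < size p)%N -> meets A B D (bin_of_nat i) (bin_of_nat j) ->
  (nth 0%num p j <= nth 0%num (peaks A B D p) i)%N.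
Proof.
move=> ip; rewrite (nth_map 0%N) ?size_iota // nth_iota // add0n.
exact: (@le_peak _ _ _ _ _ 0).
Qed.

Lemma supersolutionP (A B D P Q : N) (p : seq N) (i : nat) :
  supersolution A B D P Q p -> (i < size p)%N ->
  (0 < nth 0%num p i)%N /\
  (Q * (nth 0%num (peaks A B D p) i +
    nth 0%num (peaks A B D p) (size p - i.+1)) <= P * nth 0%num p i)%N.
Proof.
rewrite /supersolution all2E => /andP[_ /allP H] ip.
have ss : size (peaks A B D p) = size p by rewrite size_map size_iota.
set s := peaks A B D p in ss H *.
have sz : size (zip s (rev s)) = size p by rewrite size_zip size_rev ss minnn.
set d : N * N := (0%num, 0%num).
have := H (nth d (zip p [seq N.add m.1 m.2 | m <- zip s (rev s)]) i).
rewrite mem_nth; last by rewrite size_zip size_map sz minnn.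
move=> /(_ isT); rewrite nth_zip; last by rewrite size_map sz.
rewrite (nth_map d) ?sz // nth_zip ?size_rev // nth_rev ss //=.
rewrite -/s; lia.
Qed.

(** * Step functions on the grid *)

Section Cells.
Variables (R : realType) (p : seq N).
(* psi in the variable z = n * y + 1. *)
Definition cell_value (z : R) : R :=
  if 0 <= z then (nat_of_bin (nth 0%num p (Num.truncn z)))%:R else 0.

Lemma cell_value_ge0 z : 0 <= cell_value z.
Proof. by rewrite /cell_value; case: ifP. Qed.

Lemma cell_value_le (z : R) (m : nat) :
  (forall j : nat, j%:R <= z < j.+1%:R -> (j < size p)%N -> (nth 0%num p j <= m)%N) ->
  cell_value z <= m%:R.
Proof.
rewrite /cell_value; case: ifP => // z0 H; rewrite ler_nat.
have [jp|jp] := ltnP (Num.truncn z) (size p).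
  by apply: H => //; exact: truncn_itv.
by rewrite nth_default.
Qed.

Lemma cell_value_out (z : R) : z < 0 \/ (size p)%:R <= z -> cell_value z = 0.
Proof.
rewrite /cell_value; case: ifP => // z0 [|zp]; first by rewrite ltNge z0.
by rewrite nth_default // truncn_ge_nat.
Qed.

End Cells.

(** [z0] and [z1] are T0 y and T1 y in grid coordinates, where the fixed points 0 and 1 become 1 and
    [(size p).-1]. The reflection about the middle of the grid exchanges the two equations. *)
Lemma cell_value_step (R : realType) (rho : R) (A B D P Q : N) (p : seq N)
    (z z0 z1 : R) :
  supersolution A B D P Q p -> rev p = p -> (0 < D)%N -> (0 < A)%N -> (0 < Q)%N -> rho < 1 ->
  A%:R <= D%:R * rho <= B%:R ->
  z - 1 = rho * (z0 - 1) -> (size p).-1%:R - z = rho * ((size p).-1%:R - z1) ->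
  cell_value p z0 + cell_value p z1 <= P%:R / Q%:R * cell_value p z.
Proof.
move=> hp revp D0 A0 Q0 rho1 hAB e0 e1; have /andP[hA hB] := hAB.
have DR : 0 < (nat_of_bin D)%:R :> R by rewrite ltr0n.
have AR : 0 < (nat_of_bin A)%:R :> R by rewrite ltr0n.
have rho0 : 0 < rho by rewrite -(pmulr_rgt0 _ DR) (lt_le_trans AR).
set N1 : R := (size p).-1%:R in e1 *.
have N10 : 0 <= N1 * (1 - rho) by rewrite mulr_ge0 ?ler0n // subr_ge0 ltW.
(* The inverse maps expand away from fixed points inside the grid, so a point off the grid stays off
   it and both sides vanish. *)
have [zlt|zge] := ltP z 0.
  rewrite !(@cell_value_out _ p) ?mulr0 ?addr0 //; left => //; nra.
have [sp|sp] := posnP (size p).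
  by rewrite !(@cell_value_out _ p) ?mulr0 ?addr0 // sp; lra.
have N1E : (size p)%:R = N1 + 1 by rewrite /N1 natr1 prednK.
have [zlt|zout] := ltP z (size p)%:R; last first.
  rewrite !(@cell_value_out _ p) ?mulr0 ?addr0 //; right => //;
    rewrite N1E in zout *; nra.
have /andP[i1 i2] := truncn_itv zge.
set i := Num.truncn z in i1 i2.
have ip : (i < size p)%N by rewrite truncn_lt_nat.
have [c0 ci] := supersolutionP hp ip.
rewrite -[(nat_of_bin P)%:R / _]mulrC -mulrA ler_pdivlMl ?ltr0n //.
rewrite {3}/cell_value zge -/i -natrM.
move: ci; rewrite -(ler_nat R); apply: le_trans.
rewrite natrM ler_wpM2l // natrD; apply: lerD; apply: cell_value_le => j /andP[j1 j2] jp.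
  apply: nth_peaks => //; apply: (meets_ratio _ _ rho0 hAB) => //.
    by move: i2; rewrite -natr1; nra.
  by move: j2; rewrite -natr1; nra.
have subE (k : nat) : (k < size p)%N -> (size p - k.+1)%:R = N1 - k%:R :> R.
  by move=> kp; rewrite natrB // N1E -natr1; lra.
(* Reflection reverses the half-open cells, yet one of the two bounds combined in each test is still
   strict. *)
rewrite -[X in nth _ X j]revp nth_rev //; apply: nth_peaks.
  by rewrite ltn_subrL sp.
apply: (meets_ratio _ _ rho0 hAB) => //; rewrite !subE //.
  by move: j2; rewrite -natr1; nra.
by move: i2; rewrite -natr1; nra.
Qed.

(** * From a checked table to a dimension bound *)

(* The third conjunct is lam / 2 <= (A / D) ^ (u / v) for lam = P / Q. *)
Definition certified (D Q A B P : N) (u v : nat) (p : seq N) : bool :=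
  [&& N.ltb 0 A, N.ltb 0 P,
      N.leb (N.mul (iter v (N.mul P) 1%num) (iter u (N.mul D) 1%num))
            (N.mul (iter u (N.mul A) 1%num) (iter v (N.mul (N.mul 2 Q)) 1%num))
    & supersolution A B D P Q p].

Lemma nat_of_iter_mul (a : N) (k : nat) :
  nat_of_bin (iter k (N.mul a) 1%num) = (a ^ k)%N.
Proof. by elim: k => //= k IH; rewrite expnS -IH; lia. Qed.

Lemma certified_local_dim (R : realType) (rho : R)
    (mu : probability (measurableTypeR R) R) (D Q A B P : N) (u v : nat)
    (p : seq N) (s x : R) :
  rho < 1 -> bernoulli_convolution rho mu ->
  certified D Q A B P u v p -> rev p = p -> (2 < size p)%N ->
  (0 < D)%N -> (0 < Q)%N -> A%:R <= D%:R * rho <= B%:R ->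
  0 < s -> (0 < v)%N -> s < u%:R / v%:R ->
  (s%:E <= lower_local_dim mu x)%E.
Proof.
move=> rho1 hmu /and4P[hA hP hpow hp] revp szp D0 Q0 hAB s0 v0 hs.
have A0 : (0 < A)%N by clear -hA; lia.
have P0 : (0 < P)%N by clear -hP; lia.
have /andP[hAB1 hAB2] := hAB.
have DR : 0 < D%:R :> R by rewrite ltr0n.
have QR : 0 < Q%:R :> R by rewrite ltr0n.
have rho0 : 0 < rho by rewrite -(pmulr_rgt0 _ DR) (lt_le_trans _ hAB1) // ltr0n.
pose n : R := (size p - 2)%:R.
have n1 : 1 <= n by rewrite ler1n; clear -szp; lia.
have n0 : 0 < n by apply: lt_le_trans n1.
have szn : (size p)%:R = n + 2 by rewrite /n -natrD; congr _%:R; clear -szp; lia.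
have szn1 : (size p).-1%:R = n + 1 by rewrite /n natr1; congr _%:R; clear -szp; lia.
pose psi y := cell_value p (n * y + 1).
pose lam : R := P%:R / Q%:R.
have lam0 : 0 < lam by rewrite divr_gt0 ?ltr0n.
have psi_ge0 y : 0 <= psi y by exact: cell_value_ge0.
(* Half a cell: [- delta, 1 + delta] stays within the grid, where the entries are positive
   integers. *)
pose delta := (2 * n)^-1.
have nd : n * delta = 2^-1 by rewrite /delta invfM mulrCA divff ?mulr1 ?gt_eqF.
have delta0 : 0 < delta by rewrite invr_gt0 mulr_gt0.
have psi1 y : - delta <= y <= 1 + delta -> 1 <= psi y.
  move=> /andP[]; rewrite -[- delta <= _](ler_pM2l n0) -[y <= _](ler_pM2l n0).
  rewrite mulrN mulrDr nd => y1 y2.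
  have z0 : 0 <= n * y + 1 by lra.
  rewrite /psi /cell_value z0 ler1n.
  apply: (proj1 (supersolutionP hp _)).
  by rewrite truncn_lt_nat // szn; lra.
have step y : psi (y / rho) + psi ((y - 1) / rho + 1) <= lam * psi y.
  apply: (cell_value_step hp revp D0 A0 Q0 rho1 hAB); rewrite ?szn1; field;
    by rewrite gt_eqF.
have frost := frostman_bound rho0 rho1 hmu (ltW lam0) delta0 psi_ge0 psi1 step.
(* The 1 added to [psi x] keeps the constant positive where psi vanishes. *)
apply: (@le_lower_local_dim _ _ mu rho0 rho1 x (psi x + 1) delta (lam / 2) s
  (u%:R / v%:R)) => //.
- by rewrite ltr_wpDl.
- by rewrite divr_gt0.
- have vR : 0 < v%:R :> R by rewrite ltr0n.
  have kappa0 : 0 < lam / 2 by rewrite divr_gt0.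
  (* Clearing [v] turns the logarithmic bound into [(lam / 2) ^+ v <= rho ^+ u], which follows from
     the integer test through A / D. *)
  rewrite [leRHS]mulrAC ler_pdivlMr // mulrC !mulr_natl -!lnXn //.
  rewrite ler_ln ?posrE ?exprn_gt0 //.
  apply: (@le_trans _ _ ((A%:R / D%:R) ^+ u)); last first.
    by rewrite lerXn2r ?nnegrE ?divr_ge0 // ?(ltW rho0) // ler_pdivrMr // mulrC.
  have : (P ^ v * D ^ u <= A ^ u * (2 * Q) ^ v)%N.
    have -> : (2 * Q)%N = nat_of_bin (N.mul 2 Q) by clear; lia.
    by move: hpow; rewrite -!nat_of_iter_mul; clear; lia.
  rewrite -(ler_nat R) !natrM !natrX natrM (mulrC 2).
  rewrite /lam -[_ / _ / 2]mulrA -invfM !expr_div_n => hPQ.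
  have Qv : 0 < (Q%:R * 2) ^+ v :> R by rewrite exprn_gt0 // mulr_gt0.
  by rewrite ler_pdivrMr // [leRHS]mulrAC ler_pdivlMr // exprn_gt0.
- move=> m r /frost /le_trans; apply.
  have /ltW k0 : 0 < (lam / 2) ^+ m by rewrite exprn_gt0 // divr_gt0.
  by rewrite lee_fin mulrC ler_wpM2r // lerDl.
Qed.

(* An entry (B, P, h) treats the rho between the previous bound and B / D, with
   lam = P / Q and psi given by the palindrome of left half h. *)
Fixpoint covers (D Q : N) (u v : nat) (A E : N) (l : seq (N * N * seq N)) : bool :=
  if l is (B, P, h) :: l' then
    [&& (1 < size h)%N, certified D Q A B P u v (h ++ rev h) & covers D Q u v B E l']
  else N.leb E A.

Lemma covers_local_dim (R : realType) (rho : R)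
    (mu : probability (measurableTypeR R) R) (D Q : N) (u v : nat) (A E : N)
    (l : seq (N * N * seq N)) (s x : R) :
  rho < 1 -> bernoulli_convolution rho mu -> (0 < D)%N -> (0 < Q)%N ->
  0 < s -> (0 < v)%N -> s < u%:R / v%:R ->
  l != [::] -> covers D Q u v A E l -> A%:R <= D%:R * rho <= E%:R ->
  (s%:E <= lower_local_dim mu x)%E.
Proof.
move=> rho1 hmu D0 Q0 s0 v0 hs.
elim: l A => // -[[B P] h] l IH A /= _ /and3P[szh hc hl] /andP[hA hE].
have [hB|hB] := lerP (D%:R * rho) B%:R.
  apply: (certified_local_dim x rho1 hmu hc) => //; last by rewrite hA.
    by rewrite rev_cat revK.
  by rewrite size_cat size_rev; lia.
case: l hl IH => [|c l] /= EB IH; last first.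
  by apply: (IH B isT EB); rewrite ltW.
(* Beyond the last entry, the final test [E <= B] contradicts [B < D * rho]. *)
have : (nat_of_bin E <= nat_of_bin B)%N by lia.
by rewrite -(ler_nat R) => /(le_trans hE); rewrite leNgt hB.
Qed.

Lemma covers_thousandths (R : realType) (rho : R)
    (mu : probability (measurableTypeR R) R) (u v a b : nat)
    (l : seq (N * N * seq N)) (s x : R) :
  rho < 1 -> bernoulli_convolution rho mu ->
  l != [::] -> covers 1000%num 1000%num u v (bin_of_nat a) (bin_of_nat b) l ->
  0 < s -> (0 < v)%N -> s < u%:R / v%:R -> a%:R <= 1000 * rho <= b%:R ->
  (s%:E <= lower_local_dim mu x)%E.
Proof.
move=> rho1 hmu l0 hl s0 v0 hs hab.
apply: (covers_local_dim _ rho1 hmu _ _ s0 v0 hs l0 hl) => //.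
by rewrite !bin_of_natK.
Qed.

(** * The tables and their verification *)

(* Each table is the limit of the iteration psi := max (psi, F psi / lam) from
   the constant 100, rounding up, where F psi i is the largest value of
   psi o T0 + psi o T1 that the interval tests allow on cell i. *)
Definition certificate_50_55 : seq (N * N * seq N) :=
  [:: (512, 1148, [:: 100; 100; 107; 122; 122; 140; 140; 140; 122; 122; 160;
    160; 160; 122; 122; 140; 140; 140; 122; 122; 183; 183; 183; 122; 122; 140;
    140; 140; 122; 122; 160; 160; 160; 122; 122; 140; 140; 140; 122; 210;
    200]);
  (526, 1170, [:: 100; 100; 106; 124; 124; 145; 145; 145; 124; 124; 169; 169;
    169; 169; 124; 145; 145; 145; 145; 197; 197; 197; 197; 197; 124; 145; 145;
    145; 124; 124; 169; 169; 169; 169; 124; 145; 145; 145; 230; 230; 230]);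
  (539, 1196, [:: 100; 100; 100; 104; 104; 124; 124; 124; 124; 104; 148; 148;
    148; 148; 104; 104; 124; 124; 124; 174; 177; 177; 177; 177; 177; 124; 124;
    124; 124; 104; 148; 148; 148; 148; 146; 104; 124; 208; 211; 211; 208]);
  (546, 1219, [:: 100; 100; 100; 100; 100; 106; 110; 110; 110; 100; 128; 133;
    133; 133; 130; 100; 107; 110; 110; 156; 158; 162; 162; 162; 158; 158; 110;
    110; 110; 100; 130; 133; 133; 133; 130; 100; 189; 192; 192; 197; 181]);
  (550, 1232, [:: 100; 100; 100; 100; 100; 100; 100; 100; 100; 100; 100; 117;
    117; 117; 117; 100; 100; 100; 100; 100; 144; 144; 144; 144; 144; 144; 100;
    100; 100; 100; 100; 117; 117; 117; 117; 100; 163; 177; 177; 177;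
    163])]%num.

(** The exponent 4/5 exceeds 0.792021, and small [u] and [v] keep the integer powers short. Halves
    of 41 entries give 82 cells of width 1/80. *)
Lemma covers_50_55 :
  covers 1000%num 1000%num 4 5 (bin_of_nat 500) (bin_of_nat 550) certificate_50_55.
Proof. by vm_compute. Qed.

Definition certificate_55_60 : seq (N * N * seq N) :=
  [:: (554, 1220, [:: 100; 100; 100; 100; 100; 100; 106; 109; 109; 100; 100;
    129; 132; 132; 132; 100; 100; 109; 109; 109; 157; 161; 161; 161; 161; 157;
    109; 109; 109; 100; 100; 132; 132; 132; 132; 100; 172; 191; 191; 196;
    179]);
  (565, 1227, [:: 100; 100; 109; 126; 133; 147; 154; 163; 163; 158; 180; 188;
    200; 200; 200; 193; 133; 158; 163; 220; 230; 236; 245; 245; 245; 236; 230;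
    163; 163; 158; 188; 193; 200; 200; 200; 269; 282; 272; 289; 296; 300]);
  (580, 1247, [:: 100; 124; 154; 179; 191; 191; 223; 238; 238; 238; 223; 277;
    277; 296; 296; 277; 277; 256; 238; 318; 345; 345; 345; 369; 369; 345; 345;
    345; 318; 238; 277; 277; 296; 296; 396; 421; 430; 401; 429; 429; 460]);
  (600, 1275, [:: 100; 100; 100; 100; 104; 104; 120; 132; 132; 132; 152; 152;
    168; 168; 168; 168; 168; 168; 193; 193; 196; 213; 213; 213; 208; 213; 213;
    213; 196; 196; 193; 168; 246; 246; 249; 249; 271; 258; 271; 264;
    264])]%num.

(** The exponent 19/23 exceeds 0.825663 by less than 0.0005. *)
Lemma covers_55_60 :
  covers 1000%num 1000%num 19 23 (bin_of_nat 550) (bin_of_nat 600) certificate_55_60.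
Proof. by vm_compute. Qed.

Definition certificate_60_65 : seq (N * N * seq N) :=
  [:: (620, 1298, [:: 100; 100; 125; 144; 162; 186; 186; 209; 241; 241; 241;
    262; 271; 296; 312; 312; 312; 312; 330; 340; 351; 383; 383; 404; 404; 388;
    404; 404; 383; 383; 428; 417; 441; 455; 455; 497; 497; 497; 524; 503;
    495]);
  (635, 1334, [:: 100; 100; 117; 122; 155; 162; 162; 206; 206; 216; 216; 255;
    274; 274; 274; 288; 288; 288; 340; 342; 365; 365; 363; 362; 368; 384; 384;
    384; 362; 438; 453; 456; 486; 462; 483; 450; 480; 482; 480; 490; 512]);
  (649, 1361, [:: 100; 100; 100; 100; 117; 129; 133; 158; 175; 175; 180; 214;
    214; 237; 237; 237; 244; 244; 291; 291; 322; 322; 322; 322; 308; 332; 332;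
    332; 382; 396; 396; 417; 438; 435; 424; 438; 419; 419; 416; 416; 451]);
  (650, 1387, [:: 100; 100; 100; 100; 100; 100; 100; 100; 100; 100; 100; 102;
    135; 135; 135; 135; 125; 141; 176; 187; 187; 187; 187; 187; 172; 171; 195;
    195; 243; 244; 259; 259; 259; 259; 259; 249; 238; 233; 233; 237;
    270])]%num.

Lemma covers_60_65 :
  covers 1000%num 1000%num 11 13 (bin_of_nat 600) (bin_of_nat 650) certificate_60_65.
Proof. by vm_compute. Qed.

Definition certificate_65_70 : seq (N * N * seq N) :=
  [:: (670, 1396, [:: 100; 100; 138; 160; 192; 222; 238; 268; 309; 331; 331;
    374; 419; 430; 462; 462; 462; 522; 553; 584; 599; 632; 644; 644; 639; 634;
    728; 728; 771; 771; 815; 836; 882; 869; 899; 892; 884; 853; 858; 880;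
    915]);
  (688, 1432, [:: 100; 100; 111; 158; 193; 225; 276; 311; 322; 394; 412; 445;
    461; 512; 563; 589; 589; 637; 660; 718; 732; 806; 814; 843; 843; 903; 912;
    945; 991; 1027; 1047; 1119; 1154; 1165; 1207; 1193; 1176; 1153; 1162;
    1194; 1158]);
  (700, 1464, [:: 100; 100; 100; 100; 100; 123; 141; 180; 180; 205; 216; 263;
    263; 270; 300; 315; 384; 384; 385; 394; 423; 438; 460; 464; 562; 562; 537;
    563; 576; 602; 618; 641; 673; 678; 679; 722; 686; 681; 683; 699;
    701])]%num.

Lemma covers_65_70 :
  covers 1000%num 1000%num 5 6 (bin_of_nat 650) (bin_of_nat 700) certificate_65_70.
Proof. by vm_compute. Qed.

Definition certificate_70_75 : seq (N * N * seq N) :=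
  [:: (725, 1515, [:: 100; 100; 100; 127; 136; 191; 206; 245; 289; 311; 371;
    380; 437; 470; 487; 562; 575; 637; 662; 711; 737; 766; 850; 870; 921; 965;
    1002; 1033; 1076; 1116; 1160; 1181; 1187; 1218; 1257; 1267; 1270; 1286;
    1311; 1319; 1319]);
  (742, 1557, [:: 100; 100; 100; 100; 100; 117; 152; 182; 221; 236; 283; 320;
    344; 367; 440; 457; 498; 535; 571; 602; 685; 711; 751; 774; 832; 888; 932;
    936; 966; 1006; 1021; 1068; 1105; 1134; 1177; 1230; 1185; 1207; 1221;
    1217; 1222]);
  (750, 1585, [:: 100; 100; 100; 100; 100; 100; 100; 100; 100; 100; 106; 137;
    148; 158; 168; 217; 222; 234; 250; 266; 331; 343; 351; 370; 383; 395; 421;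
    424; 433; 443; 455; 486; 489; 507; 525; 566; 553; 542; 549; 553;
    541])]%num.

Lemma covers_70_75 :
  covers 1000%num 1000%num 7 9 (bin_of_nat 700) (bin_of_nat 750) certificate_70_75.
Proof. by vm_compute. Qed.

Definition certificate_75_80 : seq (N * N * seq N) :=
  [:: (782, 1650, [:: 100; 100; 100; 100; 100; 100; 100; 146; 154; 178; 240;
    254; 293; 358; 396; 419; 482; 568; 590; 653; 691; 725; 795; 836; 873; 956;
    977; 1040; 1095; 1120; 1211; 1224; 1262; 1285; 1337; 1357; 1352; 1403;
    1410; 1429; 1421]);
  (800, 1697, [:: 100; 100; 100; 100; 100; 100; 100; 100; 100; 107; 117; 143;
    180; 198; 213; 242; 304; 336; 360; 386; 409; 415; 470; 494; 510; 554; 594;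
    603; 625; 697; 731; 747; 760; 796; 810; 800; 818; 833; 846; 880;
    879])]%num.

Lemma covers_75_80 :
  covers 1000%num 1000%num 2 3 (bin_of_nat 750) (bin_of_nat 800) certificate_75_80.
Proof. by vm_compute. Qed.

Definition certificate_80_851 : seq (N * N * seq N) :=
  [:: (846, 1817, [:: 100; 100; 100; 100; 100; 100; 100; 100; 106; 152; 191;
    209; 275; 347; 379; 398; 446; 530; 587; 622; 710; 806; 863; 966; 1023;
    1099; 1194; 1255; 1292; 1408; 1478; 1566; 1598; 1639; 1692; 1725; 1746;
    1848; 1879; 1841; 1834]);
  (851, 1861, [:: 100; 100; 100; 100; 100; 100; 100; 100; 100; 100; 100; 100;
    131; 132; 135; 143; 145; 150; 165; 168; 174; 179; 206; 212; 222; 233; 240;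
    252; 258; 270; 288; 296; 303; 309; 312; 322; 329; 338; 341; 340;
    340])]%num.

Lemma covers_80_851 :
  covers 1000%num 1000%num 3 7 (bin_of_nat 800) (bin_of_nat 851) certificate_80_851.
Proof. by vm_compute. Qed.

(** * The bounds on the seven ranges of rho *)

Unset Implicit Arguments.

(* 0.792021 is written 792 / 10 ^+ 3 + 21 / 10 ^+ 6, and so on: ring_scope
   numerals are unary, and six-digit ones overflow the stack. *)
Theorem theorem4p4 (R : realType) (rho : R)
    (mu : probability (measurableTypeR R) R)
    (hrho : 50 / 10 ^+ 2 <= rho <= 851 / 10 ^+ 3)
    (hmu : bernoulli_convolution rho mu)
    (hsep : asymptotically_weak_separation rho)
    (x : R) (hx : 0 <= x <= 1) :
  (50 / 10 ^+ 2 <= rho <= 55 / 10 ^+ 2 ->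
     ((792 / 10 ^+ 3 + 21 / 10 ^+ 6)%:E <= lower_local_dim mu x)%E) /\
  (55 / 10 ^+ 2 <= rho <= 60 / 10 ^+ 2 ->
     ((825 / 10 ^+ 3 + 663 / 10 ^+ 6)%:E <= lower_local_dim mu x)%E) /\
  (60 / 10 ^+ 2 <= rho <= 65 / 10 ^+ 2 ->
     ((840 / 10 ^+ 3 + 348 / 10 ^+ 6)%:E <= lower_local_dim mu x)%E) /\
  (65 / 10 ^+ 2 <= rho <= 70 / 10 ^+ 2 ->
     ((824 / 10 ^+ 3 + 701 / 10 ^+ 6)%:E <= lower_local_dim mu x)%E) /\
  (70 / 10 ^+ 2 <= rho <= 75 / 10 ^+ 2 ->
     ((750 / 10 ^+ 3 + 984 / 10 ^+ 6)%:E <= lower_local_dim mu x)%E) /\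
  (75 / 10 ^+ 2 <= rho <= 80 / 10 ^+ 2 ->
     ((635 / 10 ^+ 3 + 12 / 10 ^+ 6)%:E <= lower_local_dim mu x)%E) /\
  (80 / 10 ^+ 2 <= rho <= 851 / 10 ^+ 3 ->
     ((416 / 10 ^+ 3 + 226 / 10 ^+ 6)%:E <= lower_local_dim mu x)%E).
Proof.
have rho1 : rho < 1 by lra.
refine (conj _ (conj _ (conj _ (conj _ (conj _ (conj _ _))))));
  move=> /andP[rho_ge rho_le].
- apply: (covers_thousandths x rho1 hmu _ covers_50_55);
    [by []|lra|by []|lra|apply/andP; split; lra].
- apply: (covers_thousandths x rho1 hmu _ covers_55_60);
    [by []|lra|by []|lra|apply/andP; split; lra].
- apply: (covers_thousandths x rho1 hmu _ covers_60_65);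
    [by []|lra|by []|lra|apply/andP; split; lra].
- apply: (covers_thousandths x rho1 hmu _ covers_65_70);
    [by []|lra|by []|lra|apply/andP; split; lra].
- apply: (covers_thousandths x rho1 hmu _ covers_70_75);
    [by []|lra|by []|lra|apply/andP; split; lra].
- apply: (covers_thousandths x rho1 hmu _ covers_75_80);
    [by []|lra|by []|lra|apply/andP; split; lra].
- apply: (covers_thousandths x rho1 hmu _ covers_80_851);
    [by []|lra|by []|lra|apply/andP; split; lra].
Qed.
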